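(* Let $g,k>0$, $\eta=7/3$, let $B=B(\mathbf{x})$ be a given time-independent bottom topography, and for $\varepsilon>0$ and $\Delta t>0$ consider the first-order semi-implicit time discretization (space kept continuous) which, given $(h^n,\mathbf{m}^n)$, determines $(h^{n+1},\mathbf{m}^{n+1})$ by $$\frac{h^{n+1}-h^n}{\Delta t}+\nabla\cdot\mathbf{m}^{n+1}=0,$$ $$\frac{\mathbf{m}^{n+1}-\mathbf{m}^n}{\Delta t}+\nabla\cdot\left(\frac{\mathbf{m}^n\otimes\mathbf{m}^n}{h^n}\right)=-\frac{1}{\varepsilon^2}\,g h^n\nabla H^{n+1}-\frac{1}{\varepsilon^2}\frac{gk^2}{(h^n)^{\eta}}\,|\mathbf{m}^{n+1}|\,\mathbf{m}^{n+1},$$ where $H^{n+1}=h^{n+1}+B$. Assume that the numerical solutions admit, for every $n$, the expansions $h^n=h^n_0+\mathcal{O}(\varepsilon)$, $\mathbf{m}^n=\mathbf{m}^n_0+\mathcal{O}(\varepsilon)$ as $\varepsilon\to0$, and that the initial conditions are well-prepared. Then the scheme is asymptotic preserving: as $\varepsilon\to 0$ (with $\Delta t$ fixed), the limit scheme satisfied by the leading-order terms $(h_0^n,\mathbf{m}_0^n)$ is a consistent time discretization of the limit system $$\partial_t h_0=\nabla\cdot\left(\sqrt{\frac{h_0^{\eta+1}}{k^2}}\,\frac{\nabla H_0}{\sqrt{|\nabla H_0|}}\right),\qquad \nabla\left(\frac g2 h_0^2\right)=-g h_0\nabla B-\gamma_0\mathbf{m}_0,$$ where $H_0=h_0+B$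 and $\gamma_0=gk^2|\mathbf{m}_0|/h_0^{\eta}$.
   Context: Model: the scheme discretizes in time the dimensionless shallow water equations with bottom topography $B$ and Manning friction, $$\partial_t h+\nabla\cdot\mathbf{m}=0,\qquad \partial_t\mathbf{m}+\nabla\cdot\left(\frac{\mathbf{m}\otimes\mathbf{m}}{h}\right)+\frac1{\varepsilon^2}\nabla\left(\frac g2h^2\right)=-\frac1{\varepsilon^2}gh\nabla B-\frac1{\varepsilon^2}\gamma\mathbf{m},\qquad \gamma=\frac{gk^2|\mathbf{m}|}{h^{\eta}},$$ with water depth $h>0$, momentum $\mathbf{m}$ (vector-valued), gravitational constant $g$, Manning coefficient $k$, $\eta=7/3$, surface level $H=h+B$, and $|\cdot|$ the Euclidean norm. Here $h^n(\mathbf{x})$, $\mathbf{m}^n(\mathbf{x})$ denote the solutions at time $t^n$, and the space variable is kept continuous. Expansions: the Chapman-Enskog form $h^n(\mathbf{x})=h_0^n(\mathbf{x})+\mathcal{O}(\varepsilon)$, $\mathbf{m}^n(\mathbf{x})=\mathbf{m}_0^n(\mathbf{x})+\mathcal{O}(\varepsilon)$ is assumed for all variables, with $H_0^n=h_0^n+B$; the expansions are understood to be compatible with spatial differentiation. Well-prepared initial conditions: at $n=0$ the expansions $h^0(\mathbf{x})=h_0^0(\mathbf{x})+\mathcal{O}(\varepsilon)$, $\mathbf{m}^0(\mathbf{x})=\mathbf{m}_0^0(\mathbf{x})+\mathcal{O}(\varepsilon)$ hold, with $H_0^0=h_0^0+B$, and the leading-order terms satisfy $$\mathbf{m}_0^0=-\sqrt{\frac{(h_0^0)^{\eta+1}}{k^2}}\,\frac{\nabla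 H_0^0}{\sqrt{|\nabla H_0^0|}}.$$ Convention: $\mathbf v/\sqrt{|\mathbf v|}=\mathbf 0$ when $\mathbf v=\mathbf 0$. Limit scheme: the system of relations between $(h_0^n,\mathbf{m}_0^n)$ and $(h_0^{n+1},\mathbf{m}_0^{n+1})$ obtained from the scheme at leading order as $\varepsilon\to0$. Consistent: inserting a sufficiently smooth exact solution of the limit system, evaluated at times $t^n$ and $t^{n+1}=t^n+\Delta t$, into the limit scheme leaves residuals that tend to $0$ as $\Delta t\to0$. *)

(* Defs.v *)
From HB Require Import structures.
From mathcomp Require Import all_boot all_order all_algebra.
From mathcomp Require Import all_classical all_reals all_analysis.

Set Implicit Arguments.
Unset Strict Implicit.
Unset Printing Implicit Defensive.

Import Order.TTheory GRing.Theory Num.Theory.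
Import numFieldNormedType.Exports.

Local Open Scope classical_set_scope.
Local Open Scope ring_scope.

Section Calculus.
Context {R : realType} {d : nat}.

(* The library norm on 'rV[R]_d is the sup norm, hence a separate Euclidean
   norm for the friction law. *)
Definition enorm (v : 'rV[R]_d) : R := Num.sqrt (\sum_(i < d) v 0 i ^+ 2).

Definition pderiv (V : normedModType R) (i : 'I_d) (f : 'rV[R]_d -> V)
  (x : 'rV[R]_d) : V := 'D_(delta_mx 0 i) f x.

Definition grad (f : 'rV[R]_d -> R) (x : 'rV[R]_d) : 'rV[R]_d :=
  \row_(i < d) pderiv i f x.

Definition divergence (v : 'rV[R]_d -> 'rV[R]_d) (x : 'rV[R]_d) : R :=
  \sum_(i < d) pderiv i (fun y => v y 0 i) x.

Definition tdivergence (S : 'rV[R]_d -> 'M[R]_d) (x : 'rV[R]_d) : 'rV[R]_d :=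
  \row_(j < d) \sum_(i < d) pderiv i (fun y => S y i j) x.

Definition tensor (u v : 'rV[R]_d) : 'M[R]_d := u^T *m v.

(* f e = f0 + O(e) as e -> 0+, at every point of Om, compatibly with first
   order spatial differentiation. *)
Definition expansion (Om : set 'rV[R]_d) (V : normedModType R)
    (f : R -> 'rV[R]_d -> V) (f0 : 'rV[R]_d -> V) : Prop :=
  forall x, Om x ->
  [/\ differentiable f0 x,
      (fun e : R => f e x - f0 x) =O_ ((0 : R)^'+) (fun e : R => e) &
      forall i : 'I_d,
        (fun e : R => pderiv i (f e) x - pderiv i f0 x)
          =O_ ((0 : R)^'+) (fun e : R => e)].

End Calculus.

Section ShallowWater.
Context {R : realType} {d : nat}.
Variables (g k : R) (B : 'rV[R]_d -> R) (Om : set 'rV[R]_d).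

Local Notation depth := ('rV[R]_d -> R).
Local Notation momentum := ('rV[R]_d -> 'rV[R]_d).

Definition eta : R := 7 / 3.

Definition surface (h : depth) : depth := fun y => h y + B y.

Definition friction (h : R) (m : 'rV[R]_d) : R :=
  g * k ^+ 2 * enorm m / h `^ eta.

(* Since 0^-1 = 0, the quotient q / sqrt |q| is 0 at q = 0. *)
Definition flux (h : R) (q : 'rV[R]_d) : 'rV[R]_d :=
  Num.sqrt (h `^ (eta + 1) / k ^+ 2) *: ((Num.sqrt (enorm q))^-1 *: q).

(* One step (h, m) -> (h', m') of the semi-implicit scheme. *)
Definition scheme (eps dt : R) (h : depth) (m : momentum)
    (h' : depth) (m' : momentum) : Prop :=
  forall x, Om x ->
    (h' x - h x) / dt + divergence m' x = 0
    /\
    dt^-1 *: (m' x - m x)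
      + tdivergence (fun y => (h y)^-1 *: tensor (m y) (m y)) x
    = - ((eps ^- 2 * (g * h x)) *: grad (surface h') x)
      - (eps ^- 2 * (g * k ^+ 2 / h x `^ eta * enorm (m' x))) *: m' x.

Definition well_prepared (h : R -> depth) (m : R -> momentum)
    (h0 : depth) (m0 : momentum) : Prop :=
  [/\ expansion Om h h0, expansion Om m m0 &
      forall x, Om x -> m0 x = - flux (h0 x) (grad (surface h0) x)].

(* Residuals of the limit scheme: the order e^0 part of the mass equation, the
   order e^-2 part of the momentum equation, and the closed evolution equation
   for the depth that results from eliminating m' between these two. *)
Definition limit_mass_residual (dt : R) (h : depth)
    (h' : depth) (m' : momentum) (x : 'rV[R]_d) : R :=
  (h' x - h x) / dt + divergence m' x.

Definition limit_momentum_residual (h : depth)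
    (h' : depth) (m' : momentum) (x : 'rV[R]_d) : 'rV[R]_d :=
  (g * h x) *: grad (surface h') x
    + (g * k ^+ 2 / h x `^ eta * enorm (m' x)) *: m' x.

Definition limit_diffusion_residual (dt : R) (h h' : depth)
    (x : 'rV[R]_d) : R :=
  (h' x - h x) / dt
    - divergence (fun y => flux (h y) (grad (surface h') y)) x.

Definition limit_scheme (dt : R) (h : depth) (h' : depth) (m' : momentum) :
    Prop :=
  forall x, Om x ->
  [/\ limit_mass_residual dt h h' m' x = 0,
      limit_momentum_residual h h' m' x = 0 &
      limit_diffusion_residual dt h h' x = 0].

Definition limit_system (T : R) (h : R -> depth) (m : R -> momentum) : Prop :=
  forall t x, 0 < t < T -> Om x ->
    derive1 (fun s => h s x) t
      = divergence (fun y => flux (h t y) (grad (surface (h t)) y)) x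
    /\
    grad (fun y => g / 2 * h t y ^+ 2) x
      = - ((g * h t x) *: grad B x) - friction (h t x) (m t x) *: m t x.

Definition cylinder (T : R) : set (R * 'rV[R]_d) :=
  [set p | 0 <= p.1 < T /\ Om p.2].

(* Smoothness up to the initial time; time derivatives only at interior times. *)
Record smooth_fields (T : R) (h : R -> depth) (m : R -> momentum) : Prop := {
  smooth_diff_h : forall t x, 0 <= t < T -> Om x -> differentiable (h t) x;
  smooth_diff_m : forall t x, 0 <= t < T -> Om x -> differentiable (m t) x;
  smooth_dt_h : forall t x, 0 < t < T -> Om x ->
    derivable (fun s => h s x) t 1;
  smooth_h : {within cylinder T, continuous (fun p => h p.1 p.2)};
  smooth_m : {within cylinder T, continuous (fun p => m p.1 p.2)};
  smooth_dx_h : forall i : 'I_d,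
    {within cylinder T, continuous (fun p => pderiv i (h p.1) p.2)};
  smooth_dx_m : forall i : 'I_d,
    {within cylinder T, continuous (fun p => pderiv i (m p.1) p.2)}
}.

(* The residuals left by any smooth exact solution of the limit system tend to 0
   with the time step, uniformly for (t, x) in compact sets. *)
Definition consistent : Prop :=
  forall (T : R) (h : R -> depth) (m : R -> momentum),
  0 < T ->
  (forall t x, 0 <= t < T -> Om x -> 0 < h t x) ->
  smooth_fields T h m ->
  limit_system T h m ->
  forall K : set (R * 'rV[R]_d), compact K -> K `<=` cylinder T ->
  forall e : R, 0 < e ->
  \forall dt \near (0 : R)^'+, forall t x, K (t, x) ->
    [/\ `|limit_mass_residual dt (h t) (h (t + dt)) (m (t + dt)) x| < e,
        `|limit_momentum_residual (h t) (h (t + dt)) (m (t + dt)) x| < e &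
        `|limit_diffusion_residual dt (h t) (h (t + dt)) x| < e].

End ShallowWater.

(* Main.v *)
(* Multiplying the momentum equation by eps ^+ 2 kills inertia and time
   derivative as eps -> 0, leaving g h grad H' = - g k^2 h^(-eta) |m'| m'; solving
   for m' gives m' = - flux h (grad H'), and inserting this in the mass equation
   gives the diffusion form of the limit scheme.

   Along an exact solution the same balance at time s = t + dt holds with
   (h(s), m(s)), so every residual is expressed by h(t), h(s), m(s) and their
   first space derivatives; the difference quotient of h is - div m at an
   intermediate time by the mean value theorem. All of these converge as
   (t, x) -> (t0, x0) and dt -> 0 jointly, and compactness (in its near-covering
   form) turns this into uniform convergence. *)

Require Import Defs.
From HB Require Import structures.
From mathcomp Require Import all_boot all_order all_algebra.
From mathcomp Require Import all_classical all_reals all_analysis.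
From mathcomp Require Import ring lra.

Import Order.TTheory GRing.Theory Num.Theory.
Import numFieldNormedType.Exports.

Local Open Scope classical_set_scope.
Local Open Scope ring_scope.

(** * The Euclidean norm *)

Lemma enorm_ge0 {R : realType} {d : nat} (v : 'rV[R]_d) : 0 <= enorm v.
Proof. exact: sqrtr_ge0. Qed.

Lemma enormZ {R : realType} {d : nat} (a : R) (v : 'rV[R]_d) :
  enorm (a *: v) = `|a| * enorm v.
Proof.
rewrite /enorm (eq_bigr (fun i => a ^+ 2 * v 0 i ^+ 2)); last first.
  by move=> i _; rewrite mxE exprMn.
by rewrite -mulr_sumr sqrtrM ?sqr_ge0// sqrtr_sqr.
Qed.

Lemma enorm_eq0 {R : realType} {d : nat} (v : 'rV[R]_d) :
  (enorm v == 0) = (v == 0).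
Proof.
apply/idP/eqP => [|->]; last first.
  by rewrite -[0](scale0r (0 : 'rV[R]_d)) enormZ normr0 mul0r.
rewrite sqrtr_eq0 => v_le0; apply/rowP => i; rewrite mxE; apply/eqP.
rewrite -sqrf_eq0 eq_le sqr_ge0 andbT (le_trans _ v_le0)// (bigD1 i)//=.
by rewrite lerDl sumr_ge0// => j _; exact: sqr_ge0.
Qed.

Lemma cvg_sumr {R : realType} {T : Type} {F : set_system T} {FF : Filter F}
    {n : nat} (f : 'I_n -> T -> R) (a : 'I_n -> R) :
  (forall i, f i x @[x --> F] --> a i) ->
  \sum_(i < n) f i x @[x --> F] --> \sum_(i < n) a i.
Proof.
by move=> fa; apply: cvg_big => //; exact: (@add_continuous R^o).
Qed.

Lemma enorm_continuous {R : realType} {d : nat} :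
  continuous (@enorm R d).
Proof.
move=> v; apply: continuous_comp; last exact: sqrt_continuous.
apply: (@cvg_sumr _ _ (nbhs v) _) => i.
have vi := @coord_continuous R 1 d 0 i v.
exact: (cvgM vi vi).
Qed.

(** * Algebra of the friction balance and inversion of the Manning law *)

Lemma friction_balance {R : realType} {d : nat} (g k h : R)
    (q m : 'rV[R]_d) : 0 < g -> 0 < h ->
  (g * h) *: q + (g * k ^+ 2 / h `^ Defs.eta * enorm m) *: m = 0 ->
  q = - ((k ^+ 2 / h `^ (Defs.eta + 1) * enorm m) *: m).
Proof.
move=> g0 h0 /eqP; rewrite addr_eq0 => /eqP /(congr1 ( *:%R (g * h)^-1)).
have gh0 : g * h != 0 by rewrite mulf_neq0 ?gt_eqF.
rewrite scalerA mulVf// scale1r => ->.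
rewrite scalerN scalerA; congr (- (_ *: _)).
rewrite powRD; last by rewrite (gt_eqF h0) implybT.
rewrite powRr1 ?(ltW h0)//.
have := powR_gt0 Defs.eta h0; set P := h `^ _ => P0.
by field; rewrite !gt_eqF.
Qed.

(** The friction force is quadratic in [m], so its norm is a perfect square and the square root in
    [flux] cancels exactly one factor [enorm m]. Two depths are kept apart because the limit scheme
    takes the mobility at the old time, while an exact solution balances friction at the new
    time. *)
Lemma flux_friction {R : realType} {d : nat} (k h h' : R) (m : 'rV[R]_d) :
    0 < k -> 0 < h -> 0 < h' ->
  flux k h (- ((k ^+ 2 / h' `^ (Defs.eta + 1) * enorm m) *: m))
  = - ((h `^ ((Defs.eta + 1) / 2) / h' `^ ((Defs.eta + 1) / 2)) *: m).
Proof.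
move=> k0 h0 h'0; rewrite /flux -[LHS]/(_ *: _).
have sq (x : R) : 0 < x ->
    x `^ (Defs.eta + 1) = (x `^ ((Defs.eta + 1) / 2)) ^+ 2.
  move=> x0; rewrite -[RHS]powR_mulrn ?powR_ge0// -powRrM.
  by congr (_ `^ _); field.
rewrite !sq//.
have := powR_gt0 ((Defs.eta + 1) / 2) h0; set P := h `^ _ => P0.
have := powR_gt0 ((Defs.eta + 1) / 2) h'0; set Q := h' `^ _ => Q0.
(* Cancelling [enorm m] needs [m] nonzero; at [m = 0] both sides vanish. *)
have [->|m0] := eqVneq m 0; first by rewrite !(scaler0, oppr0).
have nm : 0 < enorm m by rewrite lt_def enorm_eq0 m0 enorm_ge0.
rewrite -expr_div_n sqrtr_sqr ger0_norm ?divr_ge0 ?ltW//.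
rewrite -scaleNr enormZ normrN ger0_norm; last first.
  by rewrite mulr_ge0 ?divr_ge0 ?sqr_ge0 ?enorm_ge0.
have -> : k ^+ 2 / Q ^+ 2 * enorm m * enorm m = (k / Q * enorm m) ^+ 2.
  by field; rewrite gt_eqF.
rewrite sqrtr_sqr ger0_norm; last by rewrite mulr_ge0 ?divr_ge0 ?ltW.
rewrite !scalerA -[in RHS]scaleNr; congr (_ *: _).
by field; rewrite !gt_eqF.
Qed.

Lemma flux_balance {R : realType} {d : nat} (g k h : R)
    (q m : 'rV[R]_d) : 0 < g -> 0 < k -> 0 < h ->
  (g * h) *: q + (g * k ^+ 2 / h `^ Defs.eta * enorm m) *: m = 0 ->
  flux k h q = - m.
Proof.
move=> g0 k0 h0 /(friction_balance _ _ _ _ _ g0 h0) ->.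
by rewrite flux_friction// divff ?scale1r// gt_eqF// powR_gt0.
Qed.

(** * Limits extracted from the expansions *)

Lemma bigO_id_cvg {R : realType} {V : normedModType R} (u : R -> V) (l : V) :
  (fun e : R => u e - l) =O_ ((0 : R)^'+) (fun e : R => e) ->
  u e @[e --> (0 : R)^'+] --> l.
Proof.
move=> /eqOP[M [_ ub]]; apply/subr_cvg0/cvgr0Pnorm_le => e e0.
(* The bound holds eventually for every constant strictly above [M]; the maximum with 1 makes it
   positive, so that [e / K] is a valid radius. *)
pose K := Num.max (M + 1) 1.
have MK : M < K by rewrite lt_max ltrDl ltr01.
have K0 : 0 < K by rewrite lt_max ltr01 orbT.
near=> y; apply: (@le_trans _ _ (K * `|y|)); first by near: y; exact: ub.
rewrite gtr0_norm; last by near: y; exact: nbhs_right_gt.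
rewrite mulrC -ler_pdivlMr//; near: y; apply: nbhs_right_le.
exact: divr_gt0.
Unshelve. all: by end_near. Qed.

Lemma expansion_cvg {R : realType} {d : nat} {Om : set 'rV[R]_d}
    {V : normedModType R} {f : R -> 'rV[R]_d -> V} {f0 : 'rV[R]_d -> V}
    {x : 'rV[R]_d} : expansion Om f f0 -> Om x ->
  f e x @[e --> (0 : R)^'+] --> f0 x.
Proof. by move=> exp_f /exp_f[_ f_f0 _]; exact: bigO_id_cvg. Qed.

Lemma expansion_pderiv_cvg {R : realType} {d : nat} {Om : set 'rV[R]_d}
    {V : normedModType R} {f : R -> 'rV[R]_d -> V} {f0 : 'rV[R]_d -> V}
    {x : 'rV[R]_d} (i : 'I_d) : expansion Om f f0 -> Om x ->
  pderiv i (f e) x @[e --> (0 : R)^'+] --> pderiv i f0 x.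
Proof. by move=> exp_f /exp_f[_ _ f_f0]; exact: bigO_id_cvg. Qed.

Lemma pderiv_coord {R : realType} {d : nat} (i j : 'I_d)
    (m : 'rV[R]_d -> 'rV[R]_d) (x : 'rV[R]_d) : differentiable m x ->
  pderiv i (fun y => m y 0 j) x = pderiv i m x 0 j.
Proof.
by move=> dm; rewrite /pderiv derive_mx ?mxE//; exact: diff_derivable.
Qed.

Lemma differentiable_component {R : realType} {d : nat} (j : 'I_d)
    (m : 'rV[R]_d -> 'rV[R]_d) (x : 'rV[R]_d) : differentiable m x ->
  differentiable (fun y => m y 0 j) x.
Proof.
move=> dm; apply: (@differentiable_comp _ _ _ _ m (fun v => v 0 j)) => //.
exact: differentiable_coord.
Qed.

(** * Joint convergence of values and directional derivatives *)

Lemma powR_continuous {R : realType} (a : R) (u : R) : 0 < u ->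
  {for u, continuous (fun w => w `^ a)}.
Proof.
move=> u0; apply/differentiable_continuous/derivable1_diffP.
by apply: derivable_powR; rewrite in_itv/= u0.
Qed.

(* The base point may move along the filter: constant for the limit eps -> 0, and
   the moving space variable x for the limit dt -> 0. *)
Definition jet_cvg {R : realType} {V : normedModType R} {T : Type}
    (F : set_system T) (f : T -> V -> R) (x : T -> V) (v : V) (l l' : R) :=
  [/\ \forall q \near F, differentiable (f q) (x q),
      f q (x q) @[q --> F] --> l & 'D_v (f q) (x q) @[q --> F] --> l'].

Section JetConvergence.
Context {R : realType} {V : normedModType R} {T : Type} {F : set_system T}.
Context {FF : Filter F}.
Implicit Types (f g : T -> V -> R) (x : T -> V) (v : V) (l : R).

Lemma jet_cvgM f g x v l l' r r' :
  jet_cvg F f x v l l' -> jet_cvg F g x v r r' ->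
  jet_cvg F (fun q y => f q y * g q y) x v (l * r) (l * r' + r * l').
Proof.
move=> [df fl fl'] [dg gr gr']; split.
- by near do apply: differentiableM.
- exact: cvgM.
- apply: cvg_trans (cvgD (cvgM fl gr') (cvgM gr fl')).
  apply: near_eq_cvg; near=> q.
  have df' : differentiable (f q) (x q) by near: q.
  have dg' : differentiable (g q) (x q) by near: q.
  by rewrite deriveM //; exact: diff_derivable.
Unshelve. all: by end_near. Qed.

Lemma jet_cvgV f x v l l' : l != 0 ->
  jet_cvg F f x v l l' ->
  jet_cvg F (fun q y => (f q y)^-1) x v l^-1 (- l ^- 2 * l').
Proof.
move=> l0 [df fl fl'].
have f0 : \forall q \near F, f q (x q) != 0 by exact: cvgr_neq0 fl l0.
split.
- by near do apply: differentiableV.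
- exact: cvgV.
- have fV2 : (f q (x q)) ^- 2 @[q --> F] --> l ^- 2.
    by apply: cvgV; [rewrite sqrf_eq0|exact: (cvgM fl fl)].
  apply: cvg_trans (cvgM (cvgN fV2) fl').
  apply: near_eq_cvg; near=> q.
  have df' : differentiable (f q) (x q) by near: q.
  rewrite deriveV //; [by near: q|exact: diff_derivable].
Unshelve. all: by end_near. Qed.

(** Chain rule: a positive limit keeps the base eventually positive, where the real power is
    differentiable. *)
Lemma jet_cvg_powR a f x v l l' : 0 < l ->
  jet_cvg F f x v l l' ->
  jet_cvg F (fun q y => f q y `^ a) x v (l `^ a) (a * l `^ (a - 1) * l').
Proof.
move=> l0 [df fl fl'].
have f0 : \forall q \near F, 0 < f q (x q) by exact: cvgr_gt fl _ l0.
have dpow (b u : R) : 0 < u -> differentiable (fun w => w `^ b) u.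
  by move=> u0; apply/derivable1_diffP/derivable_powR; rewrite in_itv/= u0.
have cpow (b : R) : f q (x q) `^ b @[q --> F] --> l `^ b.
  exact: (continuous_cvg _ (powR_continuous b l l0) fl).
split => //.
- near=> q.
  have df' : differentiable (f q) (x q) by near: q.
  have f0' : 0 < f q (x q) by near: q.
  exact: differentiable_comp df' (dpow _ _ f0').
- apply: cvg_trans (cvgM (cvgM (cvg_cst a) (cpow (a - 1))) fl').
  apply: near_eq_cvg; near=> q.
  have df' : differentiable (f q) (x q) by near: q.
  have f0' : 0 < f q (x q) by near: q.
  rewrite deriveE; last exact: differentiable_comp df' (dpow _ _ f0').
  rewrite (@diff_comp _ _ _ _ (f q) (fun w => w `^ a)) //=; last exact: dpow.
  rewrite -(deriveE v df'); set c := 'D_v _ _.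
  (* A differential on the line is determined by its value at 1, which is the ordinary
     derivative. *)
  rewrite -[X in 'd _ _ X]mulr1 linearZ/=.
  rewrite -deriveE; last exact: dpow.
  by rewrite (@derive_val _ _ _ _ _ _ _ (is_derive1_powR a f0')) mulrC.
Unshelve. all: by end_near. Qed.

End JetConvergence.

Lemma cvg_coord {R : realType} {d : nat} {T : Type} {F : set_system T}
    {FF : Filter F} (u : T -> 'rV[R]_d) (l : 'rV[R]_d) (j : 'I_d) :
  u q @[q --> F] --> l -> u q 0 j @[q --> F] --> l 0 j.
Proof.
by move=> ul; apply: (cvg_comp u (fun v => v 0 j) ul); exact: coord_continuous.
Qed.

Lemma grad_surface {R : realType} {d : nat} (B h : 'rV[R]_d -> R)
    (x : 'rV[R]_d) : differentiable h x -> differentiable B x ->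
  grad (surface B h) x = grad h x + grad B x.
Proof.
move=> dh dB; apply/rowP => i; rewrite !mxE /pderiv.
by rewrite -[surface B h]/(h + B) deriveD//; exact: diff_derivable.
Qed.

Lemma divergence_coord {R : realType} {d : nat} (m : 'rV[R]_d -> 'rV[R]_d)
    (x : 'rV[R]_d) : differentiable m x ->
  divergence m x = \sum_(i < d) pderiv i m x 0 i.
Proof. by move=> dm; apply: eq_bigr => i _; exact: pderiv_coord. Qed.

(** * Leading order of the scheme as eps tends to 0 *)

Section LimitScheme.
Context {R : realType} {d : nat}.
Variables (g k : R) (B : 'rV[R]_d -> R) (Om : set 'rV[R]_d) (dt : R).
Variables (h h' : R -> 'rV[R]_d -> R) (m m' : R -> 'rV[R]_d -> 'rV[R]_d).
Variables (h0 h0' : 'rV[R]_d -> R) (m0 m0' : 'rV[R]_d -> 'rV[R]_d).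
Hypothesis g_gt0 : 0 < g.
Hypothesis k_gt0 : 0 < k.
Hypothesis Om_open : open Om.
Hypothesis B_diff : forall x, Om x -> differentiable B x.
Hypothesis h0_gt0 : forall x, Om x -> 0 < h0 x.
Hypothesis h_diff : forall (e : R) x, 0 < e -> Om x -> differentiable (h e) x.
Hypothesis m_diff : forall (e : R) x, 0 < e -> Om x -> differentiable (m e) x.
Hypothesis h'_diff : forall (e : R) x, 0 < e -> Om x -> differentiable (h' e) x.
Hypothesis m'_diff : forall (e : R) x, 0 < e -> Om x -> differentiable (m' e) x.
Hypothesis h_exp : expansion Om h h0.
Hypothesis m_exp : expansion Om m m0.
Hypothesis h'_exp : expansion Om h' h0'.
Hypothesis m'_exp : expansion Om m' m0'.
Hypothesis step : forall e : R, 0 < e ->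
  scheme g k B Om e dt (h e) (m e) (h' e) (m' e).

(** The mass equation carries no power of eps: its left side is 0 for every positive eps and
    converges termwise, so uniqueness of limits applies. *)
Lemma leading_order_mass x : Om x -> limit_mass_residual dt h0 h0' m0' x = 0.
Proof.
move=> Omx; rewrite /limit_mass_residual divergence_coord; last first.
  by have [] := m'_exp _ Omx.
have lhs : (h' e x - h e x) / dt + \sum_(i < d) pderiv i (m' e) x 0 i
    @[e --> (0 : R)^'+] -->
    (h0' x - h0 x) / dt + \sum_(i < d) pderiv i m0' x 0 i.
  apply: cvgD.
    apply: cvgMr_tmp.
    exact: (cvgB (expansion_cvg h'_exp Omx) (expansion_cvg h_exp Omx)).
  apply: cvg_sumr => i.
  exact: (cvg_coord _ _ i (expansion_pderiv_cvg i m'_exp Omx)).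
have := norm_cvg_unique lhs; apply => /=; apply: cvg_near_cst; near=> e.
have e0 : 0 < e by near: e; exact: nbhs_right_gt.
by rewrite -divergence_coord; [have [] := step _ e0 _ Omx|exact: m'_diff].
Unshelve. all: by end_near. Qed.

(* Only boundedness matters: this term is multiplied by eps ^+ 2. *)
Lemma inertia_cvg x (j : 'I_d) : Om x -> exists l : R,
  (dt^-1 *: (m' e x - m e x)
    + tdivergence (fun y => (h e y)^-1 *: tensor (m e y) (m e y)) x) 0 j
  @[e --> (0 : R)^'+] --> l.
Proof.
move=> Omx.
have h_near : \forall e \near (0 : R)^'+, differentiable (h e) x.
  near=> e; apply: h_diff => //; near: e; exact: nbhs_right_gt.
have m_near : \forall e \near (0 : R)^'+, differentiable (m e) x.
  near=> e; apply: m_diff => //; near: e; exact: nbhs_right_gt.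
have hj i : jet_cvg ((0 : R)^'+) h (cst x) (delta_mx 0 i)
    (h0 x) (pderiv i h0 x).
  by split; [|exact: (expansion_cvg h_exp Omx)
             |exact: (expansion_pderiv_cvg i h_exp Omx)].
have mj i a : jet_cvg ((0 : R)^'+) (fun e y => m e y 0 a) (cst x) (delta_mx 0 i)
    (m0 x 0 a) (pderiv i m0 x 0 a).
  split.
  - by apply: filterS m_near => e; exact: differentiable_component.
  - exact: (cvg_coord _ _ a (expansion_cvg m_exp Omx)).
  - apply: cvg_trans (cvg_coord _ _ a (expansion_pderiv_cvg i m_exp Omx)).
    apply: near_eq_cvg; apply: filterS m_near => e dme.
    exact/esym/pderiv_coord.
eexists; under eq_fun do rewrite !mxE.
apply: cvgD; first by apply: cvgMl_tmp;
  exact: (cvgB (cvg_coord _ _ j (expansion_cvg m'_exp Omx))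
    (cvg_coord _ _ j (expansion_cvg m_exp Omx))).
apply: cvg_sumr => i; under eq_fun do
  under [X in pderiv _ X]eq_fun do rewrite !mxE big_ord1 !mxE.
have h0n : h0 x != 0 by rewrite gt_eqF ?h0_gt0.
by have [_ _] := jet_cvgM _ _ _ _ _ _ _ _ (jet_cvgV _ _ _ _ _ h0n (hj i))
  (jet_cvgM _ _ _ _ _ _ _ _ (mj i i) (mj i j)); apply.
Unshelve. all: by end_near. Qed.

Lemma leading_order_momentum x : Om x ->
  limit_momentum_residual g k B h0 h0' m0' x = 0.
Proof.
move=> Omx; have [dh0' _ _] := h'_exp _ Omx.
rewrite /limit_momentum_residual grad_surface//; last exact: B_diff.
apply/rowP => j; have [l inertia] := inertia_cvg x j Omx.
have lhs : (g * h e x) * (pderiv j (h' e) x + pderiv j B x)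
    + (g * k ^+ 2 / h e x `^ Defs.eta * enorm (m' e x)) * m' e x 0 j
    @[e --> (0 : R)^'+] -->
  (g * h0 x) * (pderiv j h0' x + pderiv j B x)
    + (g * k ^+ 2 / h0 x `^ Defs.eta * enorm (m0' x)) * m0' x 0 j.
  have hx := expansion_cvg h_exp Omx.
  apply: cvgD; [apply: cvgM|apply: cvgM; [apply: cvgM|]].
  - exact: cvgMl_tmp.
  - by apply: cvgD; [exact: (expansion_pderiv_cvg j h'_exp Omx)|exact: cvg_cst].
  - apply: cvgMl_tmp; apply: cvgV; first by rewrite gt_eqF ?powR_gt0 ?h0_gt0.
    exact: (continuous_cvg _ (powR_continuous _ _ (h0_gt0 _ Omx)) hx).
  - exact: (continuous_cvg _ (enorm_continuous _) (expansion_cvg m'_exp Omx)).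
  - exact: (cvg_coord _ _ j (expansion_cvg m'_exp Omx)).
rewrite !mxE; have := norm_cvg_unique lhs; apply => /=.
(* By the scheme, the left side above equals minus eps squared times the inertia terms, which have a
   finite limit; the product therefore vanishes. *)
have rhs : - (e * e) * (dt^-1 *: (m' e x - m e x)
    + tdivergence (fun y => (h e y)^-1 *: tensor (m e y) (m e y)) x) 0 j
    @[e --> (0 : R)^'+] --> (0 : R).
  rewrite -[X in _ --> X](mul0r l); apply: cvgM => //.
  rewrite -[X in _ --> X]oppr0 -[X in - X](mul0r 0); apply: cvgN.
  by apply: cvgM; apply: cvg_at_right_filter; exact: cvg_id.
apply: cvg_trans rhs; apply: near_eq_cvg; near=> e.
have e0 : 0 < e by near: e; exact: nbhs_right_gt.
have [_ ->] := step _ e0 _ Omx.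
rewrite grad_surface; [|exact: h'_diff|exact: B_diff].
rewrite !mxE; set c := _ * enorm _; field.
by rewrite gt_eqF.
Unshelve. all: by end_near. Qed.

(** The momentum balance identifies the flux with [- m0'] throughout [Om]. Since [Om] is open, this
    holds near [x], so the identity may be differentiated and the mass relation becomes the
    diffusion relation. *)
Lemma leading_order_diffusion x : Om x ->
  limit_diffusion_residual k B dt h0 h0' x = 0.
Proof.
move=> Omx; rewrite -(leading_order_mass _ Omx) /limit_diffusion_residual.
congr (_ + _); rewrite /divergence -sumrN; apply: eq_bigr => i _.
have dm0' : differentiable m0' x by have [] := m'_exp _ Omx.
have dm0'i := differentiable_component i _ _ dm0'.
apply: oppr_inj; rewrite opprK /pderiv -deriveN; last exact: diff_derivable.
apply: near_eq_derive; near=> y.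
have Omy : Om y by near: y; exact: open_nbhs_nbhs.
have := leading_order_momentum _ Omy.
move=> /(flux_balance _ _ _ _ _ g_gt0 k_gt0 (h0_gt0 _ Omy)) ->.
by rewrite !mxE.
Unshelve. all: by end_near. Qed.

Lemma scheme_leading_order : limit_scheme g k B Om dt h0 h0' m0'.
Proof.
move=> x Omx; split; [exact: leading_order_mass|exact: leading_order_momentum|].
exact: leading_order_diffusion.
Qed.

End LimitScheme.

Lemma grad_half_square {R : realType} {d : nat} (g : R) (h : 'rV[R]_d -> R)
    (x : 'rV[R]_d) : differentiable h x ->
  grad (fun y => g / 2 * h y ^+ 2) x = (g * h x) *: grad h x.
Proof.
move=> /diff_derivable dh; apply/rowP => i; rewrite !mxE /pderiv.
have -> : (fun y => g / 2 * h y ^+ 2) = (g / 2) \*: (h ^+ 2) by [].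
rewrite deriveZ ?deriveX //; last exact: derivableX.
by rewrite expr1 scalerA; congr (_ * _); field.
Qed.

(** * Residuals along an exact solution *)

Section Consistency.
Context {R : realType} {d : nat}.
Variables (g k : R) (B : 'rV[R]_d -> R) (Om : set 'rV[R]_d).
Variables (T : R) (h : R -> 'rV[R]_d -> R) (m : R -> 'rV[R]_d -> 'rV[R]_d).
Hypothesis g_gt0 : 0 < g.
Hypothesis k_gt0 : 0 < k.
Hypothesis Om_open : open Om.
Hypothesis B_diff : forall x, Om x -> differentiable B x.
Hypothesis h_gt0 : forall t x, 0 <= t < T -> Om x -> 0 < h t x.
Hypothesis hm_smooth : smooth_fields Om T h m.
Hypothesis hm_limit : limit_system g k B Om T h m.

Lemma limit_system_friction t x : 0 < t < T -> Om x ->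
  grad (surface B (h t)) x
  = - ((k ^+ 2 / h t x `^ (Defs.eta + 1) * enorm (m t x)) *: m t x).
Proof.
move=> /[dup] t0T /andP[/ltW t0 tT] Omx.
have t0T' : 0 <= t < T by rewrite t0.
have hd := smooth_diff_h hm_smooth t0T' Omx.
apply: (friction_balance g _ (h t x)) => //; first exact: h_gt0.
have [_] := hm_limit _ _ t0T Omx.
rewrite grad_half_square// grad_surface//; last exact: B_diff.
rewrite /friction scalerDr => ->.
by rewrite [X in X + _]addrAC addNr add0r mulrAC addNr.
Qed.

(** The free depth [h1] will be the depth at the earlier time; taking [h1 = h t x] gives the flux
    [- m t x]. *)
Lemma limit_system_flux t h1 x : 0 < t < T -> Om x -> 0 < h1 ->
  flux k h1 (grad (surface B (h t)) x)
  = - ((h1 `^ ((Defs.eta + 1) / 2) / h t x `^ ((Defs.eta + 1) / 2)) *: m t x).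
Proof.
move=> t0T Omx h1_gt0; rewrite limit_system_friction// flux_friction//.
by apply: h_gt0 => //; case/andP: t0T => /ltW ->.
Qed.

(** Mass conservation, recovered from the diffusion form: near [x] the flux is minus the momentum,
    so their divergences are opposite. *)
Lemma limit_system_rate t x : 0 < t < T -> Om x ->
  is_derive t 1 (fun s => h s x) (- divergence (m t) x).
Proof.
move=> /[dup] t0T /andP[/ltW t0 tT] Omx; apply: DeriveDef.
  exact: smooth_dt_h hm_smooth _ _ t0T Omx.
rewrite -derive1E; have [-> _] := hm_limit _ _ t0T Omx.
have t0T' : 0 <= t < T by rewrite t0.
have dm := smooth_diff_m hm_smooth t0T' Omx.
rewrite /divergence -sumrN; apply: eq_bigr => i _.
rewrite /pderiv -deriveN; last exact/diff_derivable/differentiable_component.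
apply: near_eq_derive; near=> y.
have Omy : Om y by near: y; exact: open_nbhs_nbhs.
rewrite limit_system_flux ?h_gt0//.
by rewrite divff ?scale1r ?mxE// gt_eqF ?powR_gt0 ?h_gt0.
Unshelve. all: by end_near. Qed.

Variable p0 : R * 'rV[R]_d.
Hypothesis p0_cyl : cylinder Om T p0.

(* Points q = ((t, x), dt) with (t, x) -> p0 inside the cylinder and dt -> 0+. *)
Let G := filter_prod (within (cylinder Om T) (nbhs p0)) ((0 : R)^'+).

Local Notation H := (h p0.1 p0.2).
Local Notation M := (m p0.1 p0.2).

#[local] Instance slab_filter : Filter G.
Proof. exact: filter_prod_filter. Qed.

Lemma near_step_gt0 : \forall q \near G, 0 < q.2.
Proof.
apply: (@filter_prod2 _ _ (within (cylinder Om T) (nbhs p0)) ((0 : R)^'+) _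
  [set e | 0 < e]).
exact: nbhs_right_gt.
Qed.

(** Control is needed on the whole time segment of a step, because the mean value theorem later
    yields an unknown intermediate time. *)
Lemma near_slab (P : set (R * 'rV[R]_d)) :
  (\forall p \near within (cylinder Om T) (nbhs p0), P p) ->
  \forall q \near G, forall s, q.1.1 <= s <= q.1.1 + q.2 ->
    cylinder Om T (s, q.1.2) /\ P (s, q.1.2).
Proof.
move=> /nbhs_ballP[r /= r0 ballP]; have [/andP[t0 tT] Omx] := p0_cyl.
have T2 : 0 < (T - p0.1) / 2 by rewrite divr_gt0// subr_gt0.
(* Half of each margin is spent on the distance of the starting time from [p0.1] and half on the
   step size, so [s] stays within [r] of [p0.1] and below [T]. *)
set r' := Num.min (r / 2) ((T - p0.1) / 2).
have r'_gt0 : 0 < r' by rewrite lt_min T2 divr_gt0.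
have near1 : \forall q \near G, cylinder Om T q.1 /\ ball p0 r' q.1.
  apply: (@filter_prod1 _ _ (within (cylinder Om T) (nbhs p0)) ((0 : R)^'+) _
    [set p | cylinder Om T p /\ ball p0 r' p]).
  apply: filterS (nbhsx_ballx p0 _ r'_gt0) => p bp cp; split => //.
have near2 : \forall q \near G, 0 < q.2 < r'.
  apply: (@filter_prod2 _ _ (within (cylinder Om T) (nbhs p0)) ((0 : R)^'+) _
    [set e | 0 < e < r']).
  near=> e; apply/andP; split; near: e.
    exact: nbhs_right_gt.
  exact: nbhs_right_lt.
near=> q => s /andP[ts st].
have [[/= /andP[q0 _] Omq] [/= q1 q2]] :
  cylinder Om T q.1 /\ ball p0 r' q.1 by near: q.
have : 0 < q.2 < r' by near: q.
move: q1; rewrite /ball/= lt_min => /andP[q1r q1T] /andP[dt0].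
rewrite lt_min => /andP[dtr dtT].
have cyls : cylinder Om T (s, q.1.2).
  split => //=; rewrite (le_trans q0 ts)/=.
  by move: q1T; rewrite ltr_norml => /andP[? ?]; lra.
split => //; apply: ballP => //; split => /=.
  rewrite /ball/=; move: q1r; rewrite !ltr_norml => /andP[? ?].
  by apply/andP; split; lra.
by apply: le_ball q2; rewrite ge_min; apply/orP; left; lra.
Unshelve. all: by end_near. Qed.

Section SlabConvergence.
Context {V : normedModType R} (f : R * 'rV[R]_d -> V).
Hypothesis f_cont : {within cylinder Om T, continuous f}.

Lemma slab_cvg e : 0 < e -> \forall q \near G,
  forall s, q.1.1 <= s <= q.1.1 + q.2 -> `|f p0 - f (s, q.1.2)| <= e.
Proof.
move=> e0; move/subspace_continuousP : f_cont => /(_ _ p0_cyl).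
move=> /cvgrPdist_le/(_ _ e0) /near_slab.
by apply: filterS => q + s sq => /(_ _ sq)[].
Qed.

Lemma slab_start_cvg : f q.1 @[q --> G] --> f p0.
Proof.
move/subspace_continuousP : f_cont => /(_ _ p0_cyl) f_p0.
apply: cvg_comp f_p0; exact: cvg_fst.
Qed.

Lemma slab_end_cvg : f (q.1.1 + q.2, q.1.2) @[q --> G] --> f p0.
Proof.
apply/cvgrPdist_le => e /slab_cvg slab_e; near=> q.
apply: (near slab_e q) => //; rewrite lexx andbT lerDl ltW//.
by near: q; exact: near_step_gt0.
Unshelve. all: by end_near. Qed.

End SlabConvergence.

Lemma near_slab_cylinder : \forall q \near G, forall s,
  q.1.1 <= s <= q.1.1 + q.2 -> cylinder Om T (s, q.1.2).
Proof.
have : \forall p \near within (cylinder Om T) (nbhs p0), [set: R * 'rV[R]_d] p.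
  exact: filterT.
by move=> /near_slab; apply: filterS => q + s sq => /(_ _ sq)[].
Qed.

Lemma near_time_interior : \forall q \near G,
  [/\ 0 <= q.1.1 < T, 0 < q.1.1 + q.2 < T & Om q.1.2].
Proof.
near=> q.
have q2 : 0 < q.2 by near: q; exact: near_step_gt0.
have cyl s : q.1.1 <= s <= q.1.1 + q.2 -> cylinder Om T (s, q.1.2).
  by move: s; near: q; exact: near_slab_cylinder.
have [/= start Omq] : cylinder Om T (q.1.1, q.1.2).
  by apply: cyl; rewrite lexx lerDl ltW.
have [/= /andP[_ end_T] _] : cylinder Om T (q.1.1 + q.2, q.1.2).
  by apply: cyl; rewrite lexx lerDl ltW.
by split => //; rewrite end_T andbT; lra.
Unshelve. all: by end_near. Qed.

Lemma divergence_continuous :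
  {within cylinder Om T, continuous (fun p => divergence (m p.1) p.2)}.
Proof.
apply/subspace_continuousP => p /[dup] pcyl [tp Omp].
rewrite /from_subspace divergence_coord; last first.
  exact: (smooth_diff_m hm_smooth tp Omp).
have sumc : \sum_(i < d) pderiv i (m p'.1) p'.2 0 i
    @[p' --> within (cylinder Om T) (nbhs p)] -->
    \sum_(i < d) pderiv i (m p.1) p.2 0 i.
  apply: cvg_sumr => i; apply: cvg_coord.
  by have /subspace_continuousP/(_ _ pcyl) :=
    @smooth_dx_m _ _ _ _ _ _ hm_smooth i.
apply: cvg_trans sumc; apply: near_eq_cvg.
apply: filterS (withinT _ _) => p' [tp' Omp'].
by rewrite divergence_coord//; exact: (smooth_diff_m hm_smooth tp' Omp').
Qed.

(** The mean value theorem needs the derivative only inside the segment and mere continuity at its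
    ends, so the initial time [t = 0] is covered. *)
Lemma depth_mvt t s x : t < s -> 0 <= t -> s < T -> Om x ->
  exists2 c, t <= c <= s & h s x - h t x = - divergence (m c) x * (s - t).
Proof.
move=> ts t0 sT Omx.
have cyl c : c \in `[t, s] -> cylinder Om T (c, x).
  by rewrite in_itv/= => /andP[tc cs]; split => //=; lra.
have rate c : c \in `]t, s[ ->
    is_derive c 1 (fun c => h c x) (- divergence (m c) x).
  rewrite in_itv/= => /andP[tc cs]; apply: limit_system_rate => //.
  by apply/andP; split; lra.
(* Joint continuity on the cylinder is restricted to the time line through [x]. *)
have hc : {within `[t, s], continuous (fun c => h c x)}.
  apply/subspace_continuousP => c /= /cyl c_cyl.
  have /subspace_continuousP/(_ _ c_cyl) := smooth_h hm_smooth.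
  move=> hlim.
  apply: (cvg_comp (fun c' => (c', x)) (fun p => h p.1 p.2) _ hlim)
    => A;
  rewrite /within /= => cylA.
  have xc : {for c, continuous (fun c' : R => (c', x))}.
    apply: (@cvg_pair _ _ _ (nbhs c) (nbhs c) (nbhs x)); first exact: cvg_id.
    exact: cvg_cst.
  suff: \forall c' \near c, c' \in `[t, s] -> A (c', x) by [].
  have near_c : \forall c' \near c, cylinder Om T (c', x) -> A (c', x).
    exact: (xc _ cylA).
  by apply: filterS near_c => c' c'A /cyl.
have [c cts eq_c] := MVT_segment (ltW ts) rate hc.
by exists c; rewrite // -in_itv.
Qed.

Lemma depth_rate_cvg :
  (h (q.1.1 + q.2) q.1.2 - h q.1.1 q.1.2) / q.2 @[q --> G] -->
  - divergence (m p0.1) p0.2.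
Proof.
apply/cvgrPdist_le => e e0; near=> q.
have q2 : 0 < q.2 by near: q; exact: near_step_gt0.
have [/andP[t0 _] /andP[_ sT] Omq] :
    [/\ 0 <= q.1.1 < T, 0 < q.1.1 + q.2 < T & Om q.1.2].
  by near: q; exact: near_time_interior.
have [|c tcs ->] := depth_mvt q.1.1 (q.1.1 + q.2) q.1.2 _ t0 sT Omq.
  by rewrite ltrDl.
rewrite addrAC subrr add0r mulfK ?gt_eqF// -opprD normrN.
(* The intermediate time depends on [q]; it is generalized so that the bound uniform over the
   segment applies. *)
move: c tcs; near: q.
exact: (slab_cvg _ divergence_continuous).
Unshelve. all: by end_near. Qed.

Lemma mass_residual_cvg :
  limit_mass_residual q.2 (h q.1.1) (h (q.1.1 + q.2)) (m (q.1.1 + q.2)) q.1.2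
    @[q --> G] --> (0 : R).
Proof.
rewrite -(addNr (divergence (m p0.1) p0.2)).
apply: cvgD; first exact: depth_rate_cvg.
exact: (slab_end_cvg _ divergence_continuous).
Qed.

Let H_gt0 : 0 < H.
Proof. by case: p0_cyl => ? ?; exact: h_gt0. Qed.

(* The gradient of B need not be locally bounded, so the surface gradient at time
   t + dt is first eliminated through the exact friction balance. *)
Lemma momentum_residual_cvg :
  limit_momentum_residual g k B (h q.1.1) (h (q.1.1 + q.2)) (m (q.1.1 + q.2))
    q.1.2 @[q --> G] --> (0 : 'rV[R]_d).
Proof.
have hstart := slab_start_cvg _ (smooth_h hm_smooth).
have hend := slab_end_cvg _ (smooth_h hm_smooth).
have mend := slab_end_cvg _ (smooth_m hm_smooth).
have ncvg : enorm (m (q.1.1 + q.2) q.1.2) @[q --> G] --> enorm M.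
  exact: (continuous_cvg _ (enorm_continuous _) mend).
(* In the limit both depths equal [H], and [H] times [H ^ - (eta + 1)] is [H ^ - eta], so the two
   friction terms cancel. *)
have lim0 : (g * H) *: - ((k ^+ 2 / H `^ (Defs.eta + 1) * enorm M) *: M)
    + (g * k ^+ 2 / H `^ Defs.eta * enorm M) *: M = 0.
  rewrite scalerN scalerA -scaleNr -scalerDl powRD; last first.
    by rewrite (gt_eqF H_gt0) implybT.
  rewrite powRr1 ?ltW//.
  have /gt_eqF P0 := powR_gt0 Defs.eta H_gt0.
  have Hn0 := gt_eqF H_gt0.
  rewrite [X in X *: _](_ : _ = 0) ?scale0r//; field.
  by rewrite Hn0 P0.
rewrite -lim0.
suff : (g * h q.1.1 q.1.2) *:
      - ((k ^+ 2 / h (q.1.1 + q.2) q.1.2 `^ (Defs.eta + 1)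
          * enorm (m (q.1.1 + q.2) q.1.2)) *: m (q.1.1 + q.2) q.1.2)
    + (g * k ^+ 2 / h q.1.1 q.1.2 `^ Defs.eta
        * enorm (m (q.1.1 + q.2) q.1.2)) *: m (q.1.1 + q.2) q.1.2
    @[q --> G] --> (g * H) *: - ((k ^+ 2 / H `^ (Defs.eta + 1) * enorm M) *: M)
    + (g * k ^+ 2 / H `^ Defs.eta * enorm M) *: M.
  move=> lim; apply: cvg_trans lim; apply: near_eq_cvg.
  apply: filterS near_time_interior => q [_ sT Omq].
  by rewrite /limit_momentum_residual limit_system_friction.
have pow_neq0 a : H `^ a != 0 by rewrite gt_eqF ?powR_gt0.
(* Stated for any exponent and any depth [u] tending to [H], to serve both the old depth with [eta]
   and the new depth with [eta + 1]. *)
have friction_cvg (c a : R) (u : (R * 'rV[R]_d) * R -> R) :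
    u q @[q --> G] --> H ->
    (c / u q `^ a * enorm (m (q.1.1 + q.2) q.1.2)) *: m (q.1.1 + q.2) q.1.2
    @[q --> G] --> (c / H `^ a * enorm M) *: M.
  move=> uH.
  have ua : u q `^ a @[q --> G] --> H `^ a.
    exact: (continuous_cvg _ (powR_continuous a H H_gt0) uH).
  exact: (cvgZ (cvgM (cvgM (cvg_cst c) (cvgV (pow_neq0 a) ua)) ncvg) mend).
apply: cvgD; last exact: (friction_cvg _ _ _ hstart).
exact: (cvgZ (cvgM (cvg_cst g) hstart) (cvgN (friction_cvg _ _ _ hend))).
Qed.

(* The flux equals - (h(t) / h(t + dt)) ^ ((eta + 1) / 2) m(t + dt): this form is
   smooth even where the surface gradient vanishes, whereas q / sqrt |q| is not. *)
Lemma diffusion_flux_cvg :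
  divergence
    (fun y => flux k (h q.1.1 y) (grad (surface B (h (q.1.1 + q.2))) y)) q.1.2
    @[q --> G] --> - divergence (m p0.1) p0.2.
Proof.
have [t0T Omx0] := p0_cyl.
have dm0 := smooth_diff_m hm_smooth t0T Omx0.
rewrite divergence_coord// -sumrN.
pose a : R := (Defs.eta + 1) / 2.
have near_t : \forall q \near G, 0 <= q.1.1 < T /\ Om q.1.2.
  by apply: filterS near_time_interior => q [].
have near_s : \forall q \near G, 0 <= q.1.1 + q.2 < T /\ Om q.1.2.
  by apply: filterS near_time_interior => q [_ /andP[/ltW -> ->]].
have hstart i : jet_cvg G (fun q => h q.1.1) (fun q => q.1.2) (delta_mx 0 i)
    H (pderiv i (h p0.1) p0.2).
  split.
  - by apply: filterS near_t => q [tq Omq]; exact: (smooth_diff_h hm_smooth tq).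
  - exact: (slab_start_cvg _ (smooth_h hm_smooth)).
  - exact: (slab_start_cvg _ (@smooth_dx_h _ _ _ _ _ _ hm_smooth i)).
have hend i : jet_cvg G (fun q => h (q.1.1 + q.2)) (fun q => q.1.2)
    (delta_mx 0 i) H (pderiv i (h p0.1) p0.2).
  split.
  - by apply: filterS near_s => q [tq Omq]; exact: (smooth_diff_h hm_smooth tq).
  - exact: (slab_end_cvg _ (smooth_h hm_smooth)).
  - exact: (slab_end_cvg _ (@smooth_dx_h _ _ _ _ _ _ hm_smooth i)).
have mend i : jet_cvg G (fun q y => m (q.1.1 + q.2) y 0 i) (fun q => q.1.2)
    (delta_mx 0 i) (M 0 i) (pderiv i (m p0.1) p0.2 0 i).
  split.
  - apply: filterS near_s => q [tq Omq].
    exact/differentiable_component/(smooth_diff_m hm_smooth tq).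
  - exact: (cvg_coord _ _ i (slab_end_cvg _ (smooth_m hm_smooth))).
  - have dm := @smooth_dx_m _ _ _ _ _ _ hm_smooth i.
    apply: cvg_trans (cvg_coord _ _ i (slab_end_cvg _ dm)).
    apply: near_eq_cvg; apply: filterS near_s => q [tq Omq].
    exact/esym/pderiv_coord/(smooth_diff_m hm_smooth tq).
have P0 : H `^ a != 0 by rewrite gt_eqF ?powR_gt0.
apply: cvg_sumr => i.
have [dA _ lim] := jet_cvgM _ _ _ _ _ _ _ _
  (jet_cvgM _ _ _ _ _ _ _ _ (jet_cvg_powR a _ _ _ _ _ H_gt0 (hstart i))
    (jet_cvgV _ _ _ _ _ P0 (jet_cvg_powR a _ _ _ _ _ H_gt0 (hend i))))
  (mend i).
(* The product rule limit: old and new depth share value and gradient in the limit, so the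
   derivative of their ratio tends to 0 and only the momentum derivative survives. *)
have -> : - pderiv i (m p0.1) p0.2 0 i
  = - (H `^ a / H `^ a * pderiv i (m p0.1) p0.2 0 i +
    M 0 i * (H `^ a * (- (H `^ a) ^- 2
        * (a * H `^ (a - 1) * pderiv i (h p0.1) p0.2))
      + (H `^ a)^-1 * (a * H `^ (a - 1) * pderiv i (h p0.1) p0.2))).
  by field.
apply: cvg_trans (cvgN lim); apply: near_eq_cvg; near=> q.
have [t0 sT Omq] : [/\ 0 <= q.1.1 < T, 0 < q.1.1 + q.2 < T & Om q.1.2].
  by near: q; exact: near_time_interior.
have s0T : 0 <= q.1.1 + q.2 < T by case/andP: sT => /ltW ->.
have dAq : differentiable (fun y => h q.1.1 y `^ a
    * (h (q.1.1 + q.2) y `^ a)^-1 * m (q.1.1 + q.2) y 0 i) q.1.2 by near: q.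
transitivity (- pderiv i (fun y => h q.1.1 y `^ a
    * (h (q.1.1 + q.2) y `^ a)^-1 * m (q.1.1 + q.2) y 0 i) q.1.2) => //.
rewrite /pderiv -deriveN; last exact: diff_derivable.
apply: near_eq_derive.
(* Equality of the two fluxes on a neighbourhood, given by openness of [Om], is what equates their
   derivatives. *)
apply: filterS (open_nbhs_nbhs (conj Om_open Omq)) => y Omy.
by rewrite limit_system_flux ?h_gt0// !mxE.
Unshelve. all: by end_near. Qed.

Lemma diffusion_residual_cvg :
  limit_diffusion_residual k B q.2 (h q.1.1) (h (q.1.1 + q.2)) q.1.2
    @[q --> G] --> (0 : R).
Proof.
rewrite -(subrr (- divergence (m p0.1) p0.2)).
by apply: cvgB; [exact: depth_rate_cvg|exact: diffusion_flux_cvg].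
Qed.

End Consistency.

(** * Uniformity on compact sets and the conclusion *)

Lemma limit_scheme_consistent {R : realType} {d : nat} (g k : R)
    (B : 'rV[R]_d -> R) (Om : set 'rV[R]_d) :
  0 < g -> 0 < k -> open Om -> (forall x, Om x -> differentiable B x) ->
  consistent g k B Om.
Proof.
move=> g_gt0 k_gt0 Om_open B_diff T h m _ h_gt0 hm_smooth hm_limit.
move=> K /compact_near_coveringP/near_covering_withinP K_cover K_cyl e e_gt0.
pose good dt (p : R * 'rV[R]_d) :=
  [/\ `|limit_mass_residual dt (h p.1) (h (p.1 + dt)) (m (p.1 + dt)) p.2| < e,
    `|limit_momentum_residual g k B (h p.1) (h (p.1 + dt)) (m (p.1 + dt)) p.2|
      < e &
    `|limit_diffusion_residual k B dt (h p.1) (h (p.1 + dt)) p.2| < e].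
suff : \forall dt \near (0 : R)^'+, K `<=` good dt.
  by apply: filterS => dt K_good t x /K_good.
apply: K_cover => p0 /K_cyl p0_cyl.
have : \forall q \near
    filter_prod (within (cylinder Om T) (nbhs p0)) ((0 : R)^'+), good q.2 q.1.
  near=> q; split; near: q.
  - have /cvgr0Pnorm_lt := mass_residual_cvg g k B Om T h m g_gt0 k_gt0
      Om_open B_diff h_gt0 hm_smooth hm_limit p0 p0_cyl.
    exact.
  - have /cvgr0Pnorm_lt := momentum_residual_cvg g k B Om T h m g_gt0 
      B_diff h_gt0 hm_smooth hm_limit p0 p0_cyl.
    exact.
  - have /cvgr0Pnorm_lt := diffusion_residual_cvg g k B Om T h m g_gt0 k_gt0
      Om_open B_diff h_gt0 hm_smooth hm_limit p0 p0_cyl.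
    exact.
(* The limits are taken inside the cylinder, while the covering property asks about points of [K];
   the inclusion of [K] in the cylinder bridges the two. *)
move=> [[P Q] /= [nearP nearQ] PQ].
exists (fun p => cylinder Om T p -> P p, Q) => //= -[p dt] /= [Pp Qdt] Kp.
by apply: (PQ (p, dt)); split => //=; exact/Pp/K_cyl.
Unshelve. all: by end_near. Qed.

Theorem theorem3p1 (R : realType) (d : nat) (g k : R)
    (Om : set 'rV[R]_d) (B : 'rV[R]_d -> R) (dt : R)
    (h : R -> nat -> 'rV[R]_d -> R) (m : R -> nat -> 'rV[R]_d -> 'rV[R]_d)
    (h0 : nat -> 'rV[R]_d -> R) (m0 : nat -> 'rV[R]_d -> 'rV[R]_d)
    (d_gt0 : (0 < d)%N) (g_gt0 : 0 < g) (k_gt0 : 0 < k) (dt_gt0 : 0 < dt)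
    (Om_open : open Om)
    (B_diff : forall x, Om x -> differentiable B x)
    (h_gt0 : forall (eps : R) n x, 0 < eps -> Om x -> 0 < h eps n x)
    (h0_gt0 : forall n x, Om x -> 0 < h0 n x)
    (h_diff : forall (eps : R) n x, 0 < eps -> Om x -> differentiable (h eps n) x)
    (m_diff : forall (eps : R) n x, 0 < eps -> Om x -> differentiable (m eps n) x)
    (h_scheme : forall (eps : R) n, 0 < eps ->
       scheme g k B Om eps dt (h eps n) (m eps n) (h eps n.+1) (m eps n.+1))
    (h_exp : forall n, expansion Om (fun eps => h eps n) (h0 n))
    (m_exp : forall n, expansion Om (fun eps => m eps n) (m0 n))
    (well_prep : well_prepared k B Om (fun eps => h eps 0%N)
       (fun eps => m eps 0%N) (h0 0%N) (m0 0%N)) :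
  (forall n, limit_scheme g k B Om dt (h0 n) (h0 n.+1) (m0 n.+1))
  /\ consistent g k B Om.
Proof.
split=> [n|]; last exact: limit_scheme_consistent.
(* Expansions are available at both [n] and [n.+1], so each step passes to the limit on its own. *)
exact: (scheme_leading_order _ _ _ _ _ _ _ _ _ _ _ _ _ g_gt0 k_gt0 Om_open
  B_diff (h0_gt0 n) (h_diff^~ n) (m_diff^~ n) (h_diff^~ n.+1) (m_diff^~ n.+1)
  (h_exp n) (m_exp n) (h_exp n.+1) (m_exp n.+1) (h_scheme^~ n)).
Qed.
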